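(* As $x\to\infty$, \[ \sum_{\substack{m,n\in\mathbb{N}\\ mn\le x}} \log\operatorname{lcm}(m,n) = x(\log x)^2 + (2\gamma-2-C_{\log})\,x\log x - (2\gamma-2+D_{\log})\,x + O(x^{1/2}\log x), \] where \[ C_{\log}=-\frac{\zeta'(2)}{\zeta(2)},\qquad D_{\log}=-\frac{\zeta'(2)}{\zeta(2)}\left(2\gamma-1-2\frac{\zeta'(2)}{\zeta(2)}+2\frac{\zeta''(2)}{\zeta'(2)}\right). \]
   Context: $\zeta$ is the Riemann zeta function with derivatives $\zeta',\zeta''$; $\gamma$ is Euler's constant. The sum is over ordered pairs of positive integers $(m,n)$ with $mn\le x$. *)

(* Defs.v *)
From mathcomp Require Import all_boot all_order all_algebra.
From mathcomp Require Import all_classical all_reals all_analysis.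

Set Implicit Arguments.
Unset Strict Implicit.
Unset Printing Implicit Defensive.

Import Order.TTheory GRing.Theory Num.Theory.
Import numFieldNormedType.Exports.

Local Open Scope classical_set_scope.
Local Open Scope ring_scope.

(* Lets Landau notation be used at +oo. *)
Canonical pinfty_filter_on (R : realType) :=
  FilterType (pinfty_nbhs R) proper_pinfty_nbhs.

(* The Riemann zeta function on the real half-line s > 1, by its Dirichlet
   series; for s <= 1 the series diverges and the value is meaningless.  The
   real derivatives at a point s > 1 are the values there of the complex
   derivatives. *)
Definition zeta (R : realType) (s : R) : R :=
  limn (series (fun n : nat => n.+1%:R `^ (- s))).

(* The n-th term is 1 + 1/2 + ... + 1/(n+1) - log (n+1). *)
Definition euler_gamma (R : realType) : R :=
  limn (fun n : nat => series harmonic n.+1 - ln n.+1%:R : R).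

(* The index set is finite for every x, so the finitely supported sum below is
   the genuine one. *)
Definition hyperbola_pairs (R : realType) (x : R) : set (nat * nat) :=
  [set p | [/\ (0 < p.1)%N, (0 < p.2)%N & (p.1 * p.2)%:R <= x]].

Definition sum_log_lcm (R : realType) (x : R) : R :=
  \sum_(p \in hyperbola_pairs x) (ln (lcmn p.1 p.2)%:R : R).

Definition C_log (R : realType) : R :=
  - (derive1 (@zeta R) 2 / @zeta R 2).

Definition D_log (R : realType) : R :=
  let z := @zeta R 2 in
  let z' := derive1 (@zeta R) 2 in
  let z'' := derive1n 2 (@zeta R) 2 in
  - (z' / z) * (2 * euler_gamma R - 1 - 2 * (z' / z) + 2 * (z'' / z')).

(* Main.v *)
Require Import Defs.
From mathcomp Require Import all_boot all_order all_algebra.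
From mathcomp Require Import all_classical all_reals all_analysis.
From mathcomp Require Import ring lra zify.

Set Implicit Arguments.
Unset Strict Implicit.
Unset Printing Implicit Defensive.

Import Order.TTheory GRing.Theory Num.Theory.
Import numFieldNormedType.Exports.

Local Open Scope classical_set_scope.
Local Open Scope ring_scope.

(* Write K for the integer part of x. Since log lcm(m,n) = log m + log n -
   log gcd(m,n) and log g is the sum of Lambda(d) over d | g, the sum equals
   2 L(K) - sum_d Lambda(d) T(K / d^2), where L(y) and T(y) are the sums of log m
   and of 1 over the pairs with mn <= y.

   The hyperbola method evaluates both. For L the two occurrences of
   sum_(n <= sqrt K) (log n) / n cancel, so no constant other than gamma enters.

   In the sum over d the error of T is O(sqrt K / d) for d <= sqrt K, and it is
   summed with sum_(d <= N) Lambda(d) / d = O(log N). The main term of T is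
   summed over all d, the tail d > sqrt K being O(sqrt K log K). This leaves the
   series of Lambda(d) / d^2 and Lambda(d) log d / d^2, which the convolutions
   Lambda * 1 = log and (Lambda log) * 1 + Lambda * log = log^2 express through
   zeta, zeta' and zeta'' at 2. *)

(** * Sums over divisors and the hyperbola method *)

Lemma sum_multiples (V : nmodType) (d N : nat) (g : nat -> V) : (0 < d)%N ->
  \sum_(1 <= m < N.+1 | (d %| m)%N) g m =
  \sum_(1 <= a < (N %/ d).+1) g (d * a)%N.
Proof.
move=> d0; rewrite -big_filter -(big_map (muln d) xpredT g).
apply: perm_big; apply: uniq_perm.
- by rewrite filter_uniq // iota_uniq.
- by rewrite map_inj_uniq ?iota_uniq // => a b /eqP; rewrite eqn_pmul2l // => /eqP.
move=> m; rewrite mem_filter mem_index_iota; apply/idP/mapP.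
- case/and3P=> /dvdnP[a ->] am aN; exists a; last by rewrite mulnC.
  by rewrite mem_index_iota !ltnS leq_divRL //; nia.
- case=> a; rewrite mem_index_iota !ltnS leq_divRL // => /andP[a0 aN] ->.
  by rewrite dvdn_mulr //= muln_gt0 d0 a0 /= mulnC.
Qed.

Lemma sum_hyperbola_row (V : nmodType) (m N K : nat) (g : nat -> V) :
  (0 < m)%N -> (K %/ m <= N)%N ->
  \sum_(1 <= n < N.+1 | (m * n <= K)%N) g n =
  \sum_(1 <= n < (K %/ m).+1) g n.
Proof.
move=> m0 KN; rewrite [RHS](big_nat_widen _ _ N.+1) //.
by apply: eq_bigl => n; rewrite andTb ltnS leq_divRL // mulnC.
Qed.

Definition dirichlet_conv (R : comPzRingType) (f g : nat -> R) (n : nat) : R :=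
  \sum_(1 <= d < n.+1 | (d %| n)%N) f d * g (n %/ d)%N.

(** Both sides run over the pairs with product at most [K]: on the left they are grouped by the
    product, on the right by the first factor. *)
Lemma sum_dirichlet_conv (R : comPzRingType) (f g : nat -> R) (K : nat) :
  \sum_(1 <= n < K.+1) dirichlet_conv f g n =
  \sum_(1 <= m < K.+1) f m * \sum_(1 <= n < (K %/ m).+1) g n.
Proof.
have -> : \sum_(1 <= n < K.+1) dirichlet_conv f g n =
    \sum_(1 <= n < K.+1) \sum_(1 <= d < K.+1 | (d %| n)%N) f d * g (n %/ d)%N.
  apply: eq_big_nat => n /andP[n0 nK].
  rewrite /dirichlet_conv (big_nat_widen _ _ K.+1) //; apply: eq_bigl => d.
  by case: (boolP (d %| n)%N) => // /(dvdn_leq n0); rewrite ltnS.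
rewrite (exchange_big_dep_nat xpredT) //=; apply: eq_big_nat => d /andP[d0 dK].
rewrite sum_multiples // mulr_sumr; apply: eq_big_nat => a _.
by rewrite mulKn.
Qed.

(* A pair [(m, n)] with [m * n <= K] cannot have both coordinates above [r]; the
   pairs with both coordinates at most [r] are counted twice. *)
Lemma hyperbola_method (R : comPzRingType) (f g : nat -> R) (K r : nat) :
  (r * r <= K < r.+1 * r.+1)%N ->
  \sum_(1 <= m < K.+1) f m * \sum_(1 <= n < (K %/ m).+1) g n =
  \sum_(1 <= m < r.+1) f m * \sum_(1 <= n < (K %/ m).+1) g n
  + \sum_(1 <= n < r.+1) g n * \sum_(1 <= m < (K %/ n).+1) f m
  - (\sum_(1 <= m < r.+1) f m) * \sum_(1 <= n < r.+1) g n.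
Proof.
move=> /andP[rK Kr]; have rK' : (r <= K)%N by nia.
rewrite (big_cat_nat _ (n := r.+1)) //= -addrA; congr (_ + _).
have -> : \sum_(r.+1 <= m < K.+1) f m * \sum_(1 <= n < (K %/ m).+1) g n =
  \sum_(r.+1 <= m < K.+1) \sum_(1 <= n < r.+1 | (m * n <= K)%N) f m * g n.
  apply: eq_big_nat => m /andP[rm mK].
  rewrite sum_hyperbola_row ?mulr_sumr//; first by lia.
  by rewrite -ltnS ltn_divLR; nia.
rewrite (exchange_big_dep_nat xpredT) //= mulrC mulr_suml -sumrB.
apply: eq_big_nat => n /andP[n0 nr].
have rKn : (r <= K %/ n)%N by rewrite leq_divRL //; nia.
rewrite (big_cat_nat (n := r.+1) (p := (K %/ n).+1)) //= mulrDr addrC addKr.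
rewrite mulr_sumr [RHS](big_nat_widen _ _ K.+1) ?ltnS ?leq_div //.
rewrite big_mkcond [RHS]big_mkcond; apply: eq_big_nat => m _.
by rewrite /= ltnS leq_divRL // mulrC.
Qed.

(** The number of pairs of positive integers with product at most [K], that is, the summatory
    function of the number of divisors. *)
Definition divisor_sum (K : nat) : nat := \sum_(1 <= m < K.+1) K %/ m.

(** For fixed [d], writing [m = d * a] and [n = d * b] turns [m * n <= K] into
    [a * b <= K %/ (d * d)]. *)
Lemma sum_over_common_divisors (R : comPzRingType) (f : nat -> R) (K : nat) :
  \sum_(1 <= m < K.+1) \sum_(1 <= n < (K %/ m).+1)
     \sum_(1 <= d < K.+1 | (d %| m)%N && (d %| n)%N) f d =
  \sum_(1 <= d < K.+1) f d * (divisor_sum (K %/ (d * d)))%:R.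
Proof.
under eq_bigr do rewrite (exchange_big_dep_nat xpredT) //=.
rewrite exchange_big_nat /=; apply: eq_big_nat => d /andP[d0 dK].
have -> : \sum_(1 <= m < K.+1) \sum_(1 <= n < (K %/ m).+1 |
    (d %| m)%N && (d %| n)%N) f d =
  \sum_(1 <= m < K.+1 | (d %| m)%N) \sum_(1 <= n < (K %/ m).+1 | (d %| n)%N) f d.
  rewrite [RHS]big_mkcond; apply: eq_bigr => m _.
  by case: (d %| m)%N => //=; rewrite big_pred0_eq.
rewrite sum_multiples // natr_sum mulr_sumr.
(* The range of [a] is widened from [K %/ (d * d)] to [K %/ d]; the added rows are empty, their
   integer quotient being 0. *)
have H : (K %/ (d * d) <= K %/ d)%N by rewrite divnMA leq_div.
rewrite [RHS](big_nat_widen _ _ (K %/ d).+1) // [RHS]big_mkcond.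
apply: eq_big_nat => a /andP[a0 aK]; rewrite sum_multiples //.
rewrite big_const_nat subn1 iter_addr_0 /= mulr_natr.
have -> : (K %/ (d * a) %/ d = K %/ (d * d) %/ a)%N.
  by rewrite -!divnMA -mulnA [(a * d)%N]mulnC mulnA.
by case: ltnP => // ?; rewrite divn_small // mulr0n.
Qed.

(** * The von Mangoldt function *)

Definition von_mangoldt (R : realType) (n : nat) : R :=
  if primes n is [:: p] then ln p%:R else 0.

Lemma von_mangoldt_ge0 (R : realType) (n : nat) : 0 <= von_mangoldt R n.
Proof.
rewrite /von_mangoldt; case E: (primes n) => [|p []] //.
have : p \in primes n by rewrite E inE.
rewrite mem_primes => /and3P[/prime_gt0 p0 _ _].
by apply: ln_ge0; rewrite ler1n.
Qed.

Lemma von_mangoldt_le_ln (R : realType) (n : nat) : von_mangoldt R n <= ln n%:R.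
Proof.
have ln0n k : 0 <= ln k%:R :> R.
  by case: k => [|k]; [rewrite ln0 | apply: ln_ge0; rewrite ler1n].
rewrite /von_mangoldt; case E: (primes n) => [|p []] //.
have : p \in primes n by rewrite E inE.
rewrite mem_primes => /and3P[/prime_gt0 p0 n0 /dvdn_leq pn].
by rewrite ler_ln ?posrE ?ltr0n // ler_nat pn.
Qed.

Lemma von_mangoldt_prime_power (R : realType) (p k : nat) : prime p ->
  von_mangoldt R (p ^ k.+1) = ln p%:R.
Proof. by move=> pp; rewrite /von_mangoldt primesX // primes_prime. Qed.

(** [primes n] lists the prime divisors without multiplicity, so it is a singleton exactly at the
    prime powers; the exponent is recovered from the prime decomposition. *)
Lemma von_mangoldt_neq0 (R : realType) (n : nat) : von_mangoldt R n != 0 ->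
  exists p k, prime p /\ n = (p ^ k.+1)%N.
Proof.
rewrite /von_mangoldt; case E: (primes n) => [|p []]; rewrite ?eqxx // => _.
have : p \in primes n by rewrite E inE.
rewrite mem_primes => /and3P[pp n0 pn].
have Ep : n = (p ^ logn p n)%N.
  by rewrite [LHS]prod_prime_decomp // prime_decompE E /= big_seq1.
exists p, (logn p n).-1; split => //.
by rewrite prednK // logn_gt0 E inE.
Qed.

(** Strong induction, removing one prime factor: for [n = m * p] the divisors of [m] give log m, and
    the only other prime power dividing [n] is [p] to the exponent of [p] in [n], which gives log p.
    The range [N] is independent of [n] so that one range serves every gcd at once. *)
Lemma sum_von_mangoldt (R : realType) (N n : nat) : (0 < n <= N)%N ->
  \sum_(1 <= d < N.+1 | (d %| n)%N) von_mangoldt R d = ln n%:R.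
Proof.
elim/ltn_ind: n => n IHn /andP[n0 nN].
have [n1|n1] := leqP n 1%N.
  have -> : n = 1%N by lia.
  rewrite ln1 big1 // => d; rewrite dvdn1 => /eqP->.
  by rewrite /von_mangoldt.
have [p pp /dvdnP[m nE]] : exists2 p, prime p & (p %| n)%N.
  by exists (pdiv n); rewrite ?pdiv_prime ?pdiv_dvd.
have p1 := prime_gt1 pp; have m0 : (0 < m)%N by nia.
have mn : (m < n)%N by nia.
have p0R : (0 < p%:R :> R) by rewrite ltr0n; lia.
have m0R : (0 < m%:R :> R) by rewrite ltr0n.
rewrite nE natrM lnM ?posrE // -[ln m%:R](IHn m) //; last by lia.
rewrite (bigID (fun d => d %| m)%N) /=; congr (_ + _).
  by apply: eq_bigl => d; case: (boolP (d %| m)%N) => [dm|]; rewrite ?andbF // dvdn_mulr.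
pose e := (p ^ (logn p m).+1)%N.
have e0 : (0 < e)%N by rewrite expn_gt0; lia.
have en : (e %| m * p)%N.
  rewrite /e expnSr dvdn_pmul2r; last by lia.
  exact: pfactor_dvdnn.
have em : ~~ (e %| m)%N by rewrite pfactor_dvdn // ltnn.
have eN : (0 < e < N.+1)%N.
  by rewrite e0 ltnS (leq_trans _ nN) // dvdn_leq // nE.
(* [e] is the only prime power dividing [m * p] but not [m]. *)
rewrite (big_rem e) /= ?mem_index_iota // en em von_mangoldt_prime_power //.
rewrite big_seq_cond big1 ?addr0 // => d /andP[].
rewrite mem_rem_uniq ?iota_uniq // inE => /andP[de _] /andP[dn dm].
apply/eqP/contraT => /von_mangoldt_neq0[q [k [qp dE]]].
have dE0 : (d %| m * p)%N -> (d %| m)%N = false -> d = e.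
  have mp0 : (0 < m * p)%N by rewrite -nE.
  rewrite dE !pfactor_dvdn // lognM // ?(prime_gt0 pp) // (logn_prime _ pp).
  case: eqP => [->|_]; last by rewrite addn0 => ->.
  by rewrite addn1 => ? ?; congr (_ ^ _)%N; lia.
by rewrite (dE0 dn (negbTE dm)) eqxx in de.
Qed.

(** * Reduction of the sum of log lcm *)

Lemma sum_log_lcmE (R : realType) (x : R) : 0 <= x ->
  sum_log_lcm x = \sum_(1 <= m < (Num.truncn x).+1)
    \sum_(1 <= n < (Num.truncn x %/ m).+1) ln (lcmn m n)%:R.
Proof.
move=> x0; set K := Num.truncn x.
pose r := [seq (m, n) | m <- index_iota 1 K.+1, n <- index_iota 1 (K %/ m).+1].
have r_uniq : uniq r.
  apply: allpairs_uniq_dep => [|m _|]; [exact: iota_uniq..|].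
  by move=> [a b] [c d] _ _ /= [-> ->].
rewrite /sum_log_lcm.
have rE p : p \in r = [&& (0 < p.1)%N, (0 < p.2)%N & ((p.1 * p.2)%:R <= x)].
  rewrite -truncn_ge_nat // -/K.
  apply/allpairsPdep/and3P => [[m [n [+ + ->]]]|[m0 n0 mnK]] /=.
    rewrite !mem_index_iota !ltnS => /andP[m0 mK] /andP[n0].
    by rewrite leq_divRL // mulnC.
  exists p.1, p.2; rewrite !mem_index_iota !ltnS leq_divRL // mulnC mnK m0 n0 /=.
  by rewrite (leq_trans (leq_pmulr _ n0) mnK); split => //; case: p {m0 n0 mnK}.
have -> : hyperbola_pairs x = [set` r].
  apply/seteqP; split=> p /=; rewrite rE.
    by move=> [-> -> ->].
  by move=> /and3P[].
rewrite -fsbig_seq //.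
by rewrite big_allpairs_dep.
Qed.

Lemma sum_log_lcm_decomposition (R : realType) (x : R) : 0 <= x ->
  let K := Num.truncn x in
  sum_log_lcm x = 2 * (\sum_(1 <= m < K.+1) ln m%:R * (K %/ m)%:R)
   - \sum_(1 <= d < K.+1) von_mangoldt R d * (divisor_sum (K %/ (d * d)))%:R.
Proof.
move=> x0 K; rewrite sum_log_lcmE // -/K -sum_over_common_divisors.
have cst m : (K %/ m)%:R = \sum_(1 <= n < (K %/ m).+1) (1 : R).
  by rewrite big_const_nat subn1 /= iter_addr_0.
(* The region [m * n <= K] is symmetric, so log m and log n have the same sum over it. *)
have sym : \sum_(1 <= m < K.+1) ln m%:R * (K %/ m)%:R =
    \sum_(1 <= m < K.+1) \sum_(1 <= n < (K %/ m).+1) ln n%:R :> R.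
  have E1 : \sum_(1 <= m < K.+1) ln m%:R * (K %/ m)%:R =
      \sum_(1 <= m < K.+1) \sum_(1 <= n < K.+1 | (m * n <= K)%N) (ln m%:R : R).
    apply: eq_big_nat => m /andP[m0 _]; rewrite sum_hyperbola_row ?leq_div //.
    by rewrite cst mulr_sumr; apply: eq_bigr => *; rewrite mulr1.
  rewrite E1 (exchange_big_dep_nat xpredT) //=; apply: eq_big_nat => m /andP[m0 _].
  rewrite -(@sum_hyperbola_row _ m K) ?leq_div //.
  by apply: eq_bigl => n; rewrite mulnC.
rewrite mulrDl mul1r {2}sym -big_split -sumrB /=; apply: eq_big_nat => m /andP[m0 mK].
rewrite cst mulr_sumr -big_split -sumrB /=; apply: eq_big_nat => n /andP[n0 nK].
(* This bound allows log gcd to be expanded over divisors [d <= K]. *)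
have Hg : (0 < gcdn m n <= K)%N.
  by rewrite gcdn_gt0 m0 (leq_trans (dvdn_leq m0 (dvdn_gcdl m n))).
have l0 : (0 < lcmn m n)%N by rewrite lcmn_gt0 m0.
under eq_bigl => d do rewrite -dvdn_gcd.
rewrite sum_von_mangoldt // mulr1 -lnM ?posrE ?ltr0n // -natrM -muln_lcm_gcd.
by rewrite natrM lnM ?posrE ?ltr0n // ?addrK //; lia.
Qed.

(** * Logarithm inequalities and integer parts *)

Lemma ln_sub_le (R : realType) (a b : R) : 0 < a -> 0 < b ->
  ln b - ln a <= (b - a) / a.
Proof.
move=> a0 b0; rewrite -ln_div ?posrE // mulrBl divff ?gt_eqF //.
have := @le_ln1Dx R (b / a - 1); rewrite [1 + _]addrC subrK; apply.
by rewrite ltrBrDr addNr divr_gt0.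
Qed.

Lemma ln_sub_ge (R : realType) (a b : R) : 0 < a -> 0 < b ->
  (b - a) / b <= ln b - ln a.
Proof.
move=> a0 b0; have -> : (b - a) / b = - ((a - b) / b) by rewrite -mulNr opprB.
by have := ln_sub_le b0 a0; lra.
Qed.

Lemma ln_nat_ge0 (R : realType) (n : nat) : 0 <= ln n%:R :> R.
Proof. by case: n => [|n]; [rewrite ln0 | apply: ln_ge0; rewrite ler1n]. Qed.

Lemma ln_le_sqrt (R : realType) (y : R) : 0 < y -> ln y <= 2 * Num.sqrt y.
Proof.
move=> y0; have s0 : 0 < Num.sqrt y by rewrite sqrtr_gt0.
rewrite -[X in ln X](sqr_sqrtr (ltW y0)) lnXn // mulr2n.
by have := ln_sublinear s0; lra.
Qed.

Lemma ln_sqrt (R : realType) (y : R) : 0 < y -> ln (Num.sqrt y) = ln y / 2.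
Proof.
move=> y0; have s0 : 0 < Num.sqrt y by rewrite sqrtr_gt0.
by rewrite -[X in ln X / 2](sqr_sqrtr (ltW y0)) lnXn // mulr2n; lra.
Qed.

Lemma truncn_div_nat (R : realType) (m d : nat) : (0 < d)%N ->
  Num.truncn (m%:R / d%:R : R) = (m %/ d)%N.
Proof.
move=> d0; apply: truncn_def; have d0R : (0 < d%:R :> R) by rewrite ltr0n.
rewrite ler_pdivlMr // ltr_pdivrMr // -!natrM ler_nat ltr_nat.
by rewrite leq_divM ltn_ceil.
Qed.

Lemma truncn_ge1_itv (R : realType) (y : R) : 1 <= y ->
  [/\ 1 <= (Num.truncn y)%:R :> R, (Num.truncn y)%:R <= y & y < (Num.truncn y)%:R + 1].
Proof.
move=> y1; have y0 : 0 <= y by lra.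
have /andP[a b] := truncn_itv y0; split => //.
  by rewrite ler1n truncn_gt0.
by move: b; rewrite -natr1.
Qed.

(** * Harmonic sums and sums of logarithms *)

Lemma harmonic_approx (R : realType) (n : nat) : (0 < n)%N ->
  0 <= \sum_(1 <= i < n.+1) (i%:R)^-1 - ln n%:R - euler_gamma R <= n%:R^-1.
Proof.
move=> n0.
(* By [ln_sub_ge] the sequence [u] decreases, by [ln_sub_le] the sequence [v] increases, and they
   differ by 1/(n+1). Both therefore tend to Euler's constant, which stays between them. *)
pose u n : R := series harmonic n.+1 - ln n.+1%:R.
pose v n : R := u n - n.+1%:R^-1.
have pos k : 0 < k.+1%:R :> R by rewrite ltr0n.
have uE k : u k.+1 = u k + k.+2%:R^-1 - (ln k.+2%:R - ln k.+1%:R).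
  have e : series harmonic k.+2 = series harmonic k.+1 + k.+2%:R^-1 :> R.
    exact: seriesSr.
  rewrite /u e; set A := series _ _; set B := ln k.+2%:R; set C := ln k.+1%:R.
  by set D := _^-1; ring.
have dec : nonincreasing_seq u.
  apply/nonincreasing_seqP => k; rewrite uE.
  have := @ln_sub_ge R _ _ (pos k) (pos k.+1); rewrite -natrB // subSnn mul1r.
  by set A := ln k.+2%:R; set B := ln k.+1%:R; set D := _^-1; lra.
have inc : nondecreasing_seq v.
  apply/nondecreasing_seqP => k; rewrite /v uE.
  have := @ln_sub_le R _ _ (pos k) (pos k.+1); rewrite -natrB // subSnn mul1r.
  set A := ln k.+2%:R; set B := ln k.+1%:R; set D := k.+1%:R^-1.
  by set E := k.+2%:R^-1; lra.
have uv : (u - v) @ \oo --> 0.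
  have -> : u - v = harmonic.
    by apply/funext => k; rewrite /v /= fctE opprB addrC subrK.
  exact: cvg_harmonic.
have [E cv cu] := adjacent_seq inc dec uv.
case: n n0 => // n _; rewrite big_add1 /=.
have := nonincreasing_cvgn_ge dec cu n.
have := nondecreasing_cvgn_le inc cv n.
rewrite -E -[limn u]/(euler_gamma R) /v /u seriesEnat /=.
set A := \sum_(_ <= _ < _) _; set B := ln _; set D := _^-1 => h1 h2.
by apply/andP; split; lra.
Qed.

Lemma euler_gamma_itv (R : realType) : 0 <= euler_gamma R <= 1.
Proof.
have := @harmonic_approx R 1 isT; rewrite big_nat1 ln1 invr1 => /andP[? ?].
by apply/andP; split; lra.
Qed.

(** Induction: with [a = n + 1] and [b = a + 1], the lower bound uses a (log b - log a) <= 1 and the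
    upper bound 1 <= b (log b - log a). *)
Lemma sum_ln_approx (R : realType) (n : nat) : (0 < n)%N ->
  n%:R * ln n%:R - n%:R + 1 <= \sum_(1 <= i < n.+1) (ln i%:R : R)
    <= n%:R * ln n%:R - n%:R + 1 + ln n%:R.
Proof.
elim: n => // -[_ _|n /(_ isT) IH _]; first by rewrite big_nat1 ln1; apply/andP; lra.
move: IH; rewrite [X in _ -> _ <= X <= _]big_nat_recr //=; set S := \sum_(_ <= _ < _) _.
have a0 : 0 < n.+1%:R :> R by rewrite ltr0n.
have b0 : 0 < n.+2%:R :> R by rewrite ltr0n.
have := ln_sub_le a0 b0; have := ln_sub_ge a0 b0.
rewrite ler_pdivrMr // ler_pdivlMr // -[n.+2]addn1 natrD /=.
set a := n.+1%:R.
by move=> h4 h3 /andP[h1 h2]; apply/andP; split; nra.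
Qed.

(** The function y log y - y has derivative log y, so a move of less than 1 costs only a
    logarithm. *)
Lemma mul_ln_sub_floor (R : realType) (q y : R) : 1 <= q -> q <= y -> y < q + 1 ->
  `|(y * ln y - y) - (q * ln q - q)| <= 1 + ln y.
Proof.
move=> q1 qy yq; have q0 : 0 < q by lra.
have y0 : 0 < y by lra.
have := ln_sub_le q0 y0; have := ln_ge0 (le_trans q1 qy).
rewrite ler_pdivlMr // => l0 h.
have qy' : ln q <= ln y by rewrite ler_ln.
by rewrite ler_norml; apply/andP; split; nra.
Qed.

Lemma sum_ln_truncn_approx (R : realType) (y : R) : 1 <= y ->
  `|\sum_(1 <= i < (Num.truncn y).+1) ln i%:R - (y * ln y - y)| <= 2 * (1 + ln y).
Proof.
move=> y1; have [q1 qy yq] := truncn_ge1_itv y1.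
have := mul_ln_sub_floor q1 qy yq.
have := @sum_ln_approx R (Num.truncn y); rewrite -(ltr0n R) => H.
have /andP[h1 h2] := H (lt_le_trans ltr01 q1).
have qy' : ln (Num.truncn y)%:R <= ln y by rewrite ler_ln // posrE; lra.
rewrite !ler_norml => /andP[h3 h4]; apply/andP; split; lra.
Qed.

(** The last conjunct is the hypothesis of [hyperbola_method]. *)
Lemma isqrt_itv (R : realType) (K : nat) : (0 < K)%N ->
  let s : R := Num.sqrt K%:R in let r := Num.truncn s in
  [/\ 1 <= s, s * s = K%:R, (0 < r)%N & (r * r <= K < r.+1 * r.+1)%N].
Proof.
move=> K0 s r; have s0 : 0 <= s by exact: sqrtr_ge0.
have ss : s * s = K%:R by rewrite -expr2 sqr_sqrtr.
have K1 : 1 <= K%:R :> R by rewrite ler1n.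
have s1 : 1 <= s by rewrite -sqrtr1 ler_wsqrtr.
have [r1 rs sr] := truncn_ge1_itv s1; rewrite -/r in r1 rs sr.
split => //; first by rewrite -(ltr0n R); lra.
rewrite -(ler_nat R) -(ltr_nat R) !natrM -ss -natr1.
by apply/andP; split; nra.
Qed.

(** * Hyperbola estimates for the counts and for the logarithms *)

Lemma sum_ones_divn (R : realType) (K m : nat) :
  \sum_(1 <= n < (K %/ m).+1) (1 : R) = (K %/ m)%:R.
Proof. by rewrite big_const_nat subn1 /= iter_addr_0. Qed.

Lemma divn_real_approx (R : realType) (K m : nat) : (0 < m)%N ->
  `|(K %/ m)%:R - K%:R / m%:R| <= 1 :> R.
Proof.
move=> m0; have /andP[] : (K %/ m)%:R <= (K%:R / m%:R : R) < (K %/ m).+1%:R.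
  by rewrite -(truncn_div_nat R K m0); apply: truncn_itv; rewrite divr_ge0.
by rewrite -natr1 ler_norml => ? ?; apply/andP; split; lra.
Qed.

Lemma ler_norm_sum_nat (R : realType) (m n : nat) (f g e : nat -> R) :
  (forall i, (m <= i < n)%N -> `|f i - g i| <= e i) ->
  `|\sum_(m <= i < n) f i - \sum_(m <= i < n) g i| <= \sum_(m <= i < n) e i.
Proof.
move=> fge; rewrite -sumrB; apply: le_trans (ler_norm_sum _ _ _) _.
exact: ler_sum_nat.
Qed.

(** With [r] the integer part of [s], the error of the harmonic sum at [r] and the difference log s
    - log r both lie between 0 and 1/r, so their difference is at most 1/r in absolute value; and s
    <= 2 r. *)
Lemma harmonic_isqrt_approx (R : realType) (K : nat) : (0 < K)%N ->
  `|\sum_(1 <= i < (Num.truncn (Num.sqrt (K%:R : R))).+1) (i%:R)^-1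
    - (ln (Num.sqrt K%:R) + euler_gamma R)| * Num.sqrt K%:R <= 2.
Proof.
move=> K0; set s : R := Num.sqrt K%:R; have [s1 ss r0 _] := isqrt_itv R K0; rewrite -/s in s1 ss r0.
have [r1 rs sr] := truncn_ge1_itv s1.
have /andP[h1 h2] := @harmonic_approx R _ r0.
move: r1 rs sr h1 h2; set r := (Num.truncn s)%:R; set H := \sum_(_ <= _ < _) _.
move=> r1 rs sr h1 h2.
have r0' : 0 < r by lra.
have s0' : 0 < s by lra.
have l1 := ln_sub_le r0' s0'.
have l2 : ln r <= ln s by rewrite ler_ln.
have l3 : (s - r) / r <= r^-1.
  by rewrite ler_pdivrMr // mulVf ?gt_eqF //; lra.
have : `|H - (ln s + euler_gamma R)| <= r^-1.
  by rewrite ler_norml; apply/andP; split; lra.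
rewrite -(ler_pM2r s0') => /le_trans; apply.
by rewrite ler_pdivrMl //; lra.
Qed.

(** Dirichlet's estimate. The two halves of the hyperbola give 2 K (log s + gamma) with 2 log s =
    log K, and the doubly counted square [r * r], which is K + O(s), accounts for the -1. *)
Lemma divisor_sum_approx (R : realType) (K : nat) : (0 < K)%N ->
  `|(divisor_sum K)%:R - (K%:R * ln K%:R + (2 * euler_gamma R - 1) * K%:R)|
    <= 8 * Num.sqrt K%:R :> R.
Proof.
move=> K0; set s : R := Num.sqrt K%:R; pose r := Num.truncn s.
have [s1 ss r0 rK] := isqrt_itv R K0; rewrite -/s -/r in s1 ss r0 rK.
have [r1 rs sr] := truncn_ge1_itv s1; rewrite -/r in r1 rs sr.
have H := harmonic_isqrt_approx R K0; rewrite /= -/s -/r in H.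
have lnK : ln K%:R = 2 * ln s by rewrite ln_sqrt ?ltr0n //; lra.
have TE : (divisor_sum K)%:R =
    2 * (\sum_(1 <= m < r.+1) (K %/ m)%:R) - r%:R * r%:R :> R.
  have := hyperbola_method (fun=> 1 : R) (fun=> 1 : R) rK.
  have E n : \sum_(1 <= m < n.+1) 1 * \sum_(1 <= j < (K %/ m).+1) 1 =
      \sum_(1 <= m < n.+1) (K %/ m)%:R :> R.
    by apply: eq_bigr => m _; rewrite mul1r sum_ones_divn.
  (* Reading [r] as [r %/ 1] makes [sum_ones_divn] applicable to the square as well. *)
  rewrite !E -[r]divn1 !sum_ones_divn divn1 /divisor_sum natr_sum => ->.
  by rewrite mulrDl mul1r.
have D : `|\sum_(1 <= m < r.+1) (K %/ m)%:R - K%:R * \sum_(1 <= m < r.+1) m%:R^-1| <= r%:R :> R.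
  rewrite mulr_sumr; apply: le_trans (ler_norm_sum_nat (e := fun=> 1) _) _.
    by move=> m /andP[m0 _]; exact: divn_real_approx.
  by rewrite -[r in \sum_(1 <= _ < r.+1) _]divn1 sum_ones_divn divn1.
rewrite TE lnK; move: H D.
set H := \sum_(_ <= _ < _) _^-1; set D := \sum_(_ <= _ < _) _.
set g := euler_gamma R; set l := ln s => hH hD.
have hK : `|K%:R * H - K%:R * (l + g)| <= 2 * s.
  rewrite -mulrBr normrM -ss ger0_norm; last by nra.
  by rewrite -mulrA mulrC -mulrA; rewrite [_ * s]mulrC; nra.
move: hD hK; rewrite !ler_norml -ss => /andP[d1 d2] /andP[k1 k2].
by apply/andP; split; nra.
Qed.

(** The form needed at the rational points K / d^2. The constant is 8 from the integer case, 1 + 2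
    from 1 + log y, and 2 from 2 gamma (y - q), where [q] is the integer part. *)
Lemma divisor_sum_real_approx (R : realType) (y : R) : 1 <= y ->
  `|(divisor_sum (Num.truncn y))%:R - (y * ln y + (2 * euler_gamma R - 1) * y)|
    <= 13 * Num.sqrt y.
Proof.
move=> y1; have [q1 qy yq] := truncn_ge1_itv y1.
have q0 : (0 < Num.truncn y)%N by rewrite truncn_gt0.
have := divisor_sum_approx R q0; have := mul_ln_sub_floor q1 qy yq.
have /andP[g0 g1] := euler_gamma_itv R.
have y0 : 0 < y by lra.
have := ln_le_sqrt y0.
have : Num.sqrt (Num.truncn y)%:R <= Num.sqrt y by rewrite ler_wsqrtr.
have : 1 <= Num.sqrt y by rewrite -[leLHS]sqrtr1 ler_wsqrtr.
move: q1 qy yq; set q := (Num.truncn y)%:R; set g := euler_gamma R in g0 g1 *.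
move=> q1 qy yq s1 s2 l.
rewrite !ler_norml => /andP[h1 h2] /andP[h3 h4].
have : 0 <= g * (y - q) <= 1 by apply/andP; split; nra.
by move=> /andP[h5 h6]; apply/andP; split; lra.
Qed.

(** With [l = ln s] and log K = 2 l, the hyperbola method leaves K (2 l - 1)(l + gamma) - K (l - 1),
    which expands to the stated main term. *)
Lemma sum_ln_hyperbola_approx (R : realType) (K : nat) : (0 < K)%N ->
  `|\sum_(1 <= m < K.+1) ln m%:R * (K %/ m)%:R -
     (K%:R * ln K%:R ^+ 2 / 2 + (euler_gamma R - 1) * (K%:R * ln K%:R)
      - (euler_gamma R - 1) * K%:R)|
  <= 8 * Num.sqrt K%:R * (1 + ln K%:R) :> R.
Proof.
move=> K0; set s : R := Num.sqrt K%:R; pose r := Num.truncn s.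
have [s1 ss r0 rK] := isqrt_itv R K0; rewrite -/s -/r in s1 ss r0 rK.
have [r1 rs sr] := truncn_ge1_itv s1; rewrite -/r in r1 rs sr.
have H := harmonic_isqrt_approx R K0; rewrite /= -/s -/r in H.
have lnK : ln K%:R = 2 * ln s by rewrite ln_sqrt ?ltr0n //; lra.
have l0 : 0 <= ln s by exact: ln_ge0.
have ls : ln r%:R <= ln s by rewrite ler_ln // posrE; lra.
have rK' : (r <= K)%N by nia.
pose S n : R := \sum_(1 <= i < n.+1) ln i%:R.
(* [P] is never evaluated: it enters [E1] and [E2] with opposite signs. *)
pose P : R := \sum_(1 <= m < r.+1) ln m%:R / m%:R.
have LE : \sum_(1 <= m < K.+1) ln m%:R * (K %/ m)%:R =
    \sum_(1 <= m < r.+1) ln m%:R * (K %/ m)%:R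
    + \sum_(1 <= n < r.+1) S (K %/ n)%N - S r * r%:R :> R.
  have := hyperbola_method (fun m => ln m%:R : R) (fun=> 1 : R) rK.
  have E n : \sum_(1 <= m < n.+1) ln m%:R * \sum_(1 <= j < (K %/ m).+1) 1 =
      \sum_(1 <= m < n.+1) ln m%:R * (K %/ m)%:R :> R.
    by apply: eq_bigr => m _; rewrite sum_ones_divn.
  rewrite !E => ->; congr (_ + _ - S r * _).
    by apply: eq_bigr => m _; rewrite mul1r.
  by rewrite -[in LHS](divn1 r) sum_ones_divn divn1.
have ones : \sum_(1 <= n < r.+1) 1 = r%:R :> R.
  by rewrite -[in LHS](divn1 r) sum_ones_divn divn1.
have E1 : `|\sum_(1 <= m < r.+1) ln m%:R * (K %/ m)%:R - K%:R * P| <= s * ln s.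
  rewrite mulr_sumr; apply: le_trans (ler_norm_sum_nat (e := fun=> ln s * 1) _) _.
    move=> m /andP[m0 mr]; rewrite mulrCA -mulrBr normrM.
    rewrite ler_pM // ?divn_real_approx //.
    rewrite ger0_norm ?ln_nat_ge0 //; apply: le_trans _ ls.
    by rewrite ler_ln ?posrE ?ltr0n // ler_nat.
  by rewrite -mulr_sumr ones; nra.
have E2 : `|\sum_(1 <= n < r.+1) S (K %/ n)%N -
    K%:R * ((ln K%:R - 1) * \sum_(1 <= i < r.+1) (i%:R)^-1 - P)| <=
    2 * (1 + ln K%:R) * s.
  have -> : K%:R * ((ln K%:R - 1) * \sum_(1 <= i < r.+1) (i%:R)^-1 - P) =
    \sum_(1 <= n < r.+1) (K%:R / n%:R * ln (K%:R / n%:R) - K%:R / n%:R).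
    rewrite !mulr_sumr -sumrB mulr_sumr; apply: eq_big_nat => n /andP[n0 _].
    by rewrite ln_div ?posrE ?ltr0n //; ring.
  apply: le_trans (ler_norm_sum_nat (e := fun=> 2 * (1 + ln K%:R) * 1) _) _.
    move=> n /andP[n0 nr].
    have nK : 1 <= K%:R / n%:R :> R.
      by rewrite ler_pdivlMr ?ltr0n // mul1r ler_nat; lia.
    have := sum_ln_truncn_approx nK; rewrite truncn_div_nat // mulr1 => /le_trans; apply.
    rewrite ler_pM2l // lerD2l ln_div ?posrE ?ltr0n //.
    by have := ln_nat_ge0 R n; lra.
  by rewrite -mulr_sumr ones; nra.
have E3 : `|S r - (s * ln s - s)| <= 2 * (1 + ln s) by exact: sum_ln_truncn_approx.
have E3' : `|S r * r%:R - (s * ln s - s) * s| <= 3 * (1 + ln s) * s.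
  (* The first product carries the error of [S r], the second the rounding error s - r < 1. *)
  have -> : S r * r%:R - (s * ln s - s) * s =
    (S r - (s * ln s - s)) * r%:R - s * ((ln s - 1) * (s - r%:R)) by ring.
  apply: le_trans (ler_normB _ _) _; rewrite normrM [`|s * _|]normrM.
  have -> : `|r%:R| = r%:R :> R by rewrite ger0_norm.
  have -> : `|s| = s by rewrite ger0_norm //; lra.
  have : `|(ln s - 1) * (s - r%:R)| <= 1 + ln s.
    by rewrite ler_norml; apply/andP; split; nra.
  by move: E3; set a := `|_|; set b := `|_| => ? ?; nra.
rewrite LE lnK; move: E1 E2 E3' H; rewrite lnK.
set H := \sum_(_ <= _ < _) _^-1; set g := euler_gamma R; set l := ln s in l0 ls *.
set A := \sum_(_ <= _ < _) _; set B := \sum_(_ <= _ < _) _; set C := S r * _.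
move=> E1 E2 E3' hH.
have E4 : `|K%:R * ((2 * l - 1) * H) - K%:R * ((2 * l - 1) * (l + g))| <= 2 * s * (1 + 2 * l).
  rewrite -!mulrBr !normrM -ss (@ger0_norm _ (s * s)); last by nra.
  have : `|2 * l - 1| <= 1 + 2 * l by rewrite ler_norml; apply/andP; split; lra.
  move: hH; set a := `|_|; set b := `|_| => hH hb.
  have b0 : 0 <= b by exact: normr_ge0.
  have a0 : 0 <= a by exact: normr_ge0.
  have : b * (a * s) <= (1 + 2 * l) * 2 by apply: ler_pM => //; nra.
  by nra.
move: E1 E2 E3' E4; rewrite !ler_norml -ss => /andP[a1 a2] /andP[b1 b2] /andP[c1 c2] /andP[d1 d2].
have sl0 : 0 <= s * l by apply: mulr_ge0 => //; lra.
by apply/andP; split; lra.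
Qed.

(** * Partial sums of n^(-3/2) *)

Lemma inv_mul_sqrt_le_telescope (R : realType) (m : nat) : (0 < m)%N ->
  (m.+1%:R * Num.sqrt m.+1%:R)^-1 <=
  2 * ((Num.sqrt m%:R)^-1 - (Num.sqrt m.+1%:R)^-1) :> R.
Proof.
move=> m0; set a := Num.sqrt m%:R; set b := Num.sqrt m.+1%:R.
have a0 : 0 < a by rewrite sqrtr_gt0 ltr0n.
have b0 : 0 < b by rewrite sqrtr_gt0 ltr0n.
have aa : a * a = m%:R by rewrite -expr2 sqr_sqrtr.
have bb : b * b = m.+1%:R by rewrite -expr2 sqr_sqrtr.
have ab : a <= b by rewrite ler_wsqrtr // ler_nat.
have bb1 : b * b = a * a + 1 by rewrite bb aa -natr1.
rewrite -bb; clearbody a b; clear bb aa m0 m.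
have -> : a^-1 - b^-1 = (b - a) / (a * b).
  by field; rewrite !gt_eqF.
rewrite mulrA ler_pdivlMr; last exact: mulr_gt0.
rewrite ler_pdivrMl; last by do 2?apply: mulr_gt0.
(* From b^2 - a^2 = 1 one gets b - a = 1/(a + b) >= 1/(2 b). *)
have h1 : 1 <= 2 * b * (b - a) by nra.
have h2 : a * b <= b * b by nra.
by nra.
Qed.

(** Telescoping gives a bound uniform in [M], which serves both for convergence and for the tail
    [d > sqrt K] of the sum over common divisors. *)
Lemma sum_inv_mul_sqrt_tail (R : realType) (N M : nat) : (0 < N)%N ->
  \sum_(N.+1 <= m < M.+1) (m%:R * Num.sqrt m%:R)^-1 <= 2 / Num.sqrt N%:R :> R.
Proof.
move=> N0; have [MN|NM] := leqP M N.
  by rewrite big_geq // divr_ge0.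
suff : \sum_(N.+1 <= m < M.+1) (m%:R * Num.sqrt m%:R)^-1 <=
    2 * ((Num.sqrt N%:R)^-1 - (Num.sqrt M%:R)^-1) :> R.
  move=> /le_trans; apply; rewrite ler_pM2l // gerBl invr_ge0.
  exact: sqrtr_ge0.
rewrite big_add1 /= -opprB.
rewrite -(telescope_sumr (fun i => (Num.sqrt i%:R)^-1 : R) (ltnW NM)) -sumrN mulr_sumr.
apply: ler_sum_nat => i /andP[Ni _]; rewrite opprB.
exact: inv_mul_sqrt_le_telescope (leq_trans N0 Ni).
Qed.

Lemma cvg_series_inv_mul_sqrt (R : realType) :
  cvgn (series (fun n => (n.+1%:R * Num.sqrt n.+1%:R)^-1 : R)).
Proof.
apply: nondecreasing_is_cvgn.
  apply: nondecreasing_series => n _ _; by rewrite invr_ge0 mulr_ge0.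
(* The bound 3 is the first term 1 plus the tail bound 2 at [N = 1]. *)
exists 3 => _ [n _ <-]; case: n => [|n]; first by rewrite seriesEnat /= big_geq.
rewrite seriesEnat /= big_nat_recl //= sqrtr1 mulr1 invr1.
have := @sum_inv_mul_sqrt_tail R 1 n.+1 isT; rewrite sqrtr1 divr1 2!big_add1 /=.
by lra.
Qed.

(** * Termwise differentiation of zeta near 2 *)

Definition zeta_term (R : realType) (k : nat) (s : R) (n : nat) : R :=
  ln n.+1%:R ^+ k * n.+1%:R `^ (- s).

(* Up to the sign [(-1)^k], the [k]-th derivative of [zeta]; the series is only
   shown to converge for [s >= 7/4], a neighbourhood of 2 being all that is
   needed. *)
Definition zeta_deriv (R : realType) (k : nat) (s : R) : R :=
  limn (series (zeta_term k s)).

Lemma zeta_termE (R : realType) (k : nat) (s : R) (n : nat) :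
  zeta_term k s n = ln n.+1%:R ^+ k * expR (- s * ln n.+1%:R).
Proof. by rewrite /zeta_term /powR pnatr_eq0. Qed.

Lemma zeta_term_ge0 (R : realType) (k : nat) (s : R) (n : nat) :
  0 <= zeta_term k s n.
Proof. by rewrite mulr_ge0 ?powR_ge0 // exprn_ge0 // ln_nat_ge0. Qed.

(** One term of the exponential series, (l/4)^k / k! <= exp (l/4), bounds the power of the logarithm
    by a multiple of n^(1/4), and n^(1/4) n^(-7/4) = n^(-3/2). *)
Lemma zeta_term_le (R : realType) (k : nat) (s : R) : 7 / 4 <= s ->
  forall n, zeta_term k s n <=
    (4 ^+ k * k`!%:R) * (n.+1%:R * Num.sqrt n.+1%:R)^-1.
Proof.
move=> s74 n; rewrite zeta_termE; set l := ln n.+1%:R.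
have l0 : 0 <= l by exact: ln_nat_ge0.
have n0 : 0 < n.+1%:R :> R by rewrite ltr0n.
have -> : (n.+1%:R * Num.sqrt n.+1%:R)^-1 = expR (- (3 / 2) * l) :> R.
  have -> : - (3 / 2) * l = - (l + l / 2) by field.
  rewrite expRN expRD -ln_sqrt // !lnK ?posrE ?sqrtr_gt0 //.
have f0 : 0 < k`!%:R :> R by rewrite ltr0n fact_gt0.
have lk : l ^+ k <= (4 ^+ k * k`!%:R) * expR (l / 4).
  have : (l / 4) ^+ k / k`!%:R <= expR (l / 4).
    case: k {f0} => [|k].
      rewrite expr0 fact0 divr1 -[leLHS]expR0 ler_expR; lra.
    have := @expR_ge1Dxn R (l / 4) k; have h : 0 <= l / 4 by lra.
    by move=> /(_ h); lra.
  rewrite expr_div_n ler_pdivrMr // ler_pdivrMr ?exprn_gt0 //.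
  by have -> : 4 ^+ k * k`!%:R * expR (l / 4) = expR (l / 4) * k`!%:R * 4 ^+ k by ring.
have -> : expR (- (3 / 2) * l) = expR (l / 4) * expR (- (7 / 4) * l).
  by rewrite -expRD; congr expR; field.
rewrite mulrA; apply: ler_pM => //.
- exact: exprn_ge0.
- by rewrite ler_expR; nra.
Qed.

Lemma cvg_zeta_term (R : realType) (k : nat) (s : R) : 7 / 4 <= s ->
  cvgn (series (zeta_term k s)).
Proof.
move=> s74.
apply: (@series_le_cvg _ _ (fun n => (4 ^+ k * k`!%:R) *
  (n.+1%:R * Num.sqrt n.+1%:R)^-1)); first exact: zeta_term_ge0.
- move=> n; apply: le_trans (zeta_term_ge0 k s n) _; exact: zeta_term_le.
- exact: zeta_term_le.
- have H : cvgn (series ((4 ^+ k * k`!%:R) *: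
    (fun n => (n.+1%:R * Num.sqrt n.+1%:R)^-1 : R))).
    by apply: is_cvg_seriesZ; exact: cvg_series_inv_mul_sqrt.
  exact: H.
Qed.

(** Multiplying 1 - u <= exp (-u) by exp u gives exp u - 1 <= u exp u, so the remainder is at most u
    (exp u - 1); the sign of [u] decides how this is bounded. *)
Lemma expR_taylor1_le (R : realType) (u : R) :
  0 <= expR u - 1 - u <= u ^+ 2 * expR `|u|.
Proof.
have h1 := expR_ge1Dx u; have h2 := expR_ge1Dx (- u).
have e0 := expR_gt0 u.
have h3 : expR u * expR (- u) = 1 by rewrite -expRD subrr expR0.
have h4 : expR u - 1 <= u * expR u by nra.
apply/andP; split; first by lra.
have [u0|u0] := leP 0 u; first by rewrite (ger0_norm u0) expr2; nra.
rewrite (ltr0_norm u0); have : 1 <= expR (- u) by rewrite -[leLHS]expR0 ler_expR; lra.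
by rewrite expr2; nra.
Qed.

(** The exponential remainder is taken at u = -h l; its factor exp |u| is at most exp (l/8),
    absorbed by lowering the exponent from [s] to [s - 1 / 8]. *)
Lemma zeta_term_taylor (R : realType) (k : nat) (s h : R) (n : nat) :
  `|h| <= 1 / 8 ->
  `|zeta_term k (h + s) n - zeta_term k s n + h * zeta_term k.+1 s n|
    <= h ^+ 2 * zeta_term k.+2 (s - 1 / 8) n.
Proof.
move=> h8; rewrite !zeta_termE; set l := ln n.+1%:R.
have l0 : 0 <= l by exact: ln_nat_ge0.
have -> : expR (- (h + s) * l) = expR (- s * l) * expR (- h * l).
  by rewrite -expRD; congr expR; ring.
have -> : - (s - 1 / 8) * l = - s * l + (1 / 8) * l by ring.
rewrite expRD [l ^+ k.+2]exprS [l ^+ k.+1]exprS.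
have := expR_taylor1_le (- h * l).
have lk0 : 0 <= l ^+ k by exact: exprn_ge0.
have E0 := expR_gt0 (- s * l).
have e8 : expR `|- h * l| <= expR (1 / 8 * l).
  by rewrite ler_expR normrM normrN (ger0_norm l0) ler_wpM2r.
move: (expR `|_|) e8 => e8 e8le /andP[t0 t1].
move: (expR (- s * l)) E0 (expR (1 / 8 * l)) e8le (expR (- h * l)) t0 t1 => E E0 F e8F G t0 t1.
have -> : l ^+ k * (E * G) - l ^+ k * E + h * (l * l ^+ k * E) =
  (l ^+ k * E) * (G - 1 - - h * l) by ring.
have -> : h ^+ 2 * (l * (l * l ^+ k) * (E * F)) =
  (l ^+ k * E) * ((- h * l) ^+ 2 * F) by ring.
have P0 : 0 <= l ^+ k * E by apply: mulr_ge0 => //; exact: ltW.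
rewrite normrM (ger0_norm P0) (ger0_norm t0) ler_wpM2l //.
by apply: (le_trans t1); rewrite ler_wpM2l // sqr_ge0.
Qed.

Lemma zeta_deriv_taylor (R : realType) (k : nat) (s h : R) :
  15 / 8 <= s -> `|h| <= 1 / 8 ->
  `|zeta_deriv k (h + s) - zeta_deriv k s + h * zeta_deriv k.+1 s|
    <= h ^+ 2 * zeta_deriv k.+2 (s - 1 / 8).
Proof.
move=> s158 h8.
have /andP[h1 h2] : - (1 / 8) <= h <= 1 / 8 by rewrite -ler_norml.
(* The bound 15/8 on [s] keeps both [h + s] and [s - 1 / 8] at or above 7/4, where the series
   converge. *)
have c1 := @cvg_zeta_term R k (h + s) ltac:(lra).
have c2 := @cvg_zeta_term R k s ltac:(lra).
have c3 := @cvg_zeta_term R k.+1 s ltac:(lra).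
have c4 := @cvg_zeta_term R k.+2 (s - 1 / 8) ltac:(lra).
have cL : (fun N => `|series (zeta_term k (h + s)) N - series (zeta_term k s) N
    + h * series (zeta_term k.+1 s) N|) @ \oo -->
    `|zeta_deriv k (h + s) - zeta_deriv k s + h * zeta_deriv k.+1 s|.
  by apply: cvg_norm; exact: cvgD (cvgB c1 c2) (cvgM (cvg_cst h) c3).
have cR : (fun N => h ^+ 2 * series (zeta_term k.+2 (s - 1 / 8)) N) @ \oo -->
    h ^+ 2 * zeta_deriv k.+2 (s - 1 / 8).
  by exact: cvgM (cvg_cst _) c4.
apply: (ler_cvg_to cL cR); near=> N.
rewrite !seriesEnat /= -sumrB !mulr_sumr -big_split /=.
apply: le_trans (ler_norm_sum _ _ _) _; apply: ler_sum => n _.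
exact: zeta_term_taylor.
Unshelve. all: by end_near. Qed.

(** The quadratic Taylor remainder makes the error of the difference quotient at most |h| times the
    constant [C], so no uniform convergence argument is required. *)
Lemma is_derive_zeta_deriv (R : realType) (k : nat) (s : R) : 15 / 8 <= s ->
  is_derive s (1 : R) (@zeta_deriv R k) (- zeta_deriv k.+1 s).
Proof.
move=> s158; set C := zeta_deriv k.+2 (s - 1 / 8).
have H : (fun h => h^-1 *: ((@zeta_deriv R k \o shift s) (h *: (1 : R)) - zeta_deriv k s))
    @ 0^' --> - zeta_deriv k.+1 s.
  apply/cvgrPdist_le => e e0.
  (* The first entry permits the Taylor bound, the second makes |h| [C] at most [e]. *)
  have d0 : 0 < Num.min (1 / 8) (e / (1 + `|C|)).
    rewrite lt_min; apply/andP; split; first by lra.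
    by rewrite divr_gt0 //; have := normr_ge0 C; lra.
  near=> h.
  have hn0 : h != 0 by near: h; exact: nbhs_dnbhs_neq.
  have : `|h| <= Num.min (1 / 8) (e / (1 + `|C|)).
    near: h; apply: (@dnbhs0_le R R); exact: d0.
  rewrite le_min => /andP[h8]; rewrite ler_pdivlMr; last by have := normr_ge0 C; lra.
  move=> hC.
  have := zeta_deriv_taylor k s158 h8; rewrite -/C /= /shift /= scaler1 => T.
  have -> : - zeta_deriv k.+1 s - h^-1 *: (zeta_deriv k (h + s) - zeta_deriv k s) =
     - (h^-1 * (zeta_deriv k (h + s) - zeta_deriv k s + h * zeta_deriv k.+1 s)).
    by rewrite /GRing.scale /=; field.
  rewrite normrN normrM normfV ler_pdivrMl ?normr_gt0 //.
  apply: (le_trans T); rewrite -real_normK ?num_real // expr2 -mulrA.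
  rewrite ler_wpM2l //; have := ler_norm C; have := normr_ge0 h.
  by move: hC; set a := `|h|; set b := `|C|; nra.
apply: DeriveDef; first by apply: cvgP H.
exact: cvg_lim H.
Unshelve. all: by end_near. Qed.

Lemma zeta_deriv0 (R : realType) : @zeta R = zeta_deriv 0.
Proof.
apply/funext => s; rewrite /zeta /zeta_deriv; congr (limn (series _)).
by apply/funext => n; rewrite /zeta_term expr0 mul1r.
Qed.

Lemma derive1_zeta (R : realType) (s : R) : 15 / 8 <= s ->
  derive1 (@zeta R) s = - zeta_deriv 1 s.
Proof.
by move=> s0; rewrite zeta_deriv0 derive1E; have [_ ->] := is_derive_zeta_deriv 0 s0.
Qed.

Lemma derive1n2_zeta (R : realType) : derive1n 2 (@zeta R) 2 = zeta_deriv 2 2.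
Proof.
rewrite -[derive1n 2 _]/(derive1 (derive1 (@zeta R))) derive1E.
(* The formula for the first derivative is available on a neighbourhood of 2, which is enough to
   differentiate it there. *)
rewrite (@near_eq_derive _ _ _ _ (- @zeta_deriv R 1)); last first.
  near=> s; rewrite derive1_zeta //.
  apply: ltW; near: s; apply: open_nbhs_nbhs; split; first exact: open_gt.
  by rewrite /=; lra.
have h2 : 15 / 8 <= 2 :> R by lra.
have D := is_derive_zeta_deriv 1 h2.
have := @is_deriveN _ _ _ _ _ _ _ D; rewrite opprK => -[_ ->] //.
Unshelve. all: by end_near. Qed.

(** * Dirichlet series of the von Mangoldt function at 2 *)

Lemma cvg_dirichlet_conv (R : realType) (a b : nat -> R) (alpha beta : R) :
  (forall n, 0 <= a n) -> (forall n, 0 <= b n) ->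
  (fun N => \sum_(1 <= n < N.+1) a n) @ \oo --> alpha ->
  (fun N => \sum_(1 <= n < N.+1) b n) @ \oo --> beta ->
  (fun N => \sum_(1 <= n < N.+1) dirichlet_conv a b n) @ \oo --> alpha * beta.
Proof.
move=> a0 b0; set A := (X in X @ _ --> _ -> _); set B := (X in X @ _ --> _ -> _ @ _ --> _).
set C := (X in _ -> _ -> X @ _ --> _) => cA cB.
have mono (f : nat -> R) : (forall n, 0 <= f n) ->
    nondecreasing_seq (fun N => \sum_(1 <= n < N.+1) f n).
  move=> f0; apply/nondecreasing_seqP => N.
  by rewrite [leRHS]big_nat_recr //= lerDl.
have c0 n : 0 <= dirichlet_conv a b n by apply: sumr_ge0 => d _; exact: mulr_ge0.
have A0 N : 0 <= A N by apply: sumr_ge0.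
have B0 N : 0 <= B N by apply: sumr_ge0.
have Aa N : A N <= alpha.
  by rewrite -(cvg_lim _ cA) //; apply: nondecreasing_cvgn_le; [exact: mono | exact: cvgP cA].
have Bb N : B N <= beta.
  by rewrite -(cvg_lim _ cB) //; apply: nondecreasing_cvgn_le; [exact: mono | exact: cvgP cB].
have CAB N : C N <= A N * B N.
  rewrite /C sum_dirichlet_conv /A mulr_suml; apply: ler_sum => m _.
  by rewrite ler_wpM2l //; apply: (mono b b0); exact: leq_div.
have CU N : C N <= alpha * beta by apply: (le_trans (CAB N)); exact: ler_pM.
have cC : cvgn C.
  by apply: nondecreasing_is_cvgn; [exact: mono | exists (alpha * beta) => _ [N _ <-]].
(* Indices at most [N] have product at most [N * N], so every term of the product of partial sums
   occurs in [C (N * N)]. *)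
have ABC N : A N * B N <= C (N * N)%N.
  rewrite /C sum_dirichlet_conv (big_cat_nat (n := N.+1)) //=; last by rewrite ltnS; nia.
  rewrite -[leLHS]addr0; apply: lerD; last first.
    by apply: sumr_ge0 => m _; apply: mulr_ge0 => //; exact: sumr_ge0.
  rewrite /A mulr_suml; apply: ler_sum_nat => m /andP[m0 mN].
  by rewrite ler_wpM2l //; apply: (mono b b0); rewrite leq_divRL //; nia.
suff -> : alpha * beta = limn C by [].
(* [C N <= A N * B N <= C (N * N)] *)
apply/eqP; rewrite eq_le; apply/andP; split.
  have cAB : (A \* B) @ \oo --> alpha * beta by exact: cvgM cA cB.
  rewrite -(cvg_lim _ cAB) //.
  apply: limr_le; first exact: cvgP cAB.
  near=> N; apply: (le_trans (ABC N)).
  by apply: nondecreasing_cvgn_le => //; exact: mono.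
by apply: limr_le => //; near=> N.
Unshelve. all: by end_near. Qed.

Lemma cvg_sum_ln_pow (R : realType) (k : nat) :
  (fun N => \sum_(1 <= n < N.+1) (ln n%:R ^+ k / n%:R ^+ 2 : R)) @ \oo
    --> zeta_deriv k (2 : R).
Proof.
have -> : (fun N => \sum_(1 <= n < N.+1) (ln n%:R ^+ k / n%:R ^+ 2 : R)) =
    series (zeta_term k (2 : R)).
  apply/funext => N; rewrite big_add1 seriesEnat /=; apply: eq_bigr => n _.
  by rewrite /zeta_term powR_invn.
by apply: cvg_zeta_term; lra.
Qed.

(** One or two terms already give the positivity of zeta(2) and -zeta'(2), by which later identities
    divide. *)
Lemma zeta_deriv_ge_partial (R : realType) (k N : nat) :
  \sum_(1 <= n < N.+1) (ln n%:R ^+ k / n%:R ^+ 2 : R) <= zeta_deriv k (2 : R).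
Proof.
have cv := @cvg_sum_ln_pow R k; rewrite -(cvg_lim _ cv) //.
apply: (nondecreasing_cvgn_le (u_ := fun N => \sum_(1 <= n < N.+1) _) _ (cvgP _ cv)).
apply/nondecreasing_seqP => M; rewrite [leRHS]big_nat_recr //= lerDl.
by rewrite divr_ge0 ?exprn_ge0 // ln_nat_ge0.
Qed.

Lemma zeta_deriv0_gt0 (R : realType) : 0 < zeta_deriv 0 (2 : R).
Proof.
have := @zeta_deriv_ge_partial R 0 1; rewrite big_nat1 expr0 expr1n divr1.
exact: lt_le_trans.
Qed.

Lemma zeta_deriv1_gt0 (R : realType) : 0 < zeta_deriv 1 (2 : R).
Proof.
have := @zeta_deriv_ge_partial R 1 2; rewrite big_nat_recr //= big_nat1 ln1 mul0r add0r.
by apply: lt_le_trans; rewrite divr_gt0 ?exprn_gt0 ?ln_gt0 // ltr1n.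
Qed.

(** Since Lambda <= log, comparison with the series for exponent [k.+1] applies. *)
Lemma is_cvg_von_mangoldt (R : realType) (k : nat) :
  cvgn (fun N => \sum_(1 <= n < N.+1)
    (von_mangoldt R n * ln n%:R ^+ k / n%:R ^+ 2 : R)).
Proof.
have -> : (fun N => \sum_(1 <= n < N.+1)
    (von_mangoldt R n * ln n%:R ^+ k / n%:R ^+ 2 : R)) =
    series (fun n => von_mangoldt R n.+1 * ln n.+1%:R ^+ k / n.+1%:R ^+ 2 : R).
  by apply/funext => N; rewrite big_add1 seriesEnat.
apply: (@series_le_cvg _ _ (zeta_term k.+1 2)).
- move=> n; rewrite divr_ge0 // mulr_ge0 ?von_mangoldt_ge0 // exprn_ge0 //.
  exact: ln_nat_ge0.
- exact: zeta_term_ge0.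
- move=> n; rewrite /zeta_term powR_invn // [ln _ ^+ k.+1]exprS ler_wpM2r //.
  by rewrite ler_wpM2r ?von_mangoldt_le_ln // exprn_ge0 // ln_nat_ge0.
- by apply: cvg_zeta_term; lra.
Qed.

Lemma von_mangoldt_weight_ge0 (R : realType) (k n : nat) :
  0 <= von_mangoldt R n * ln n%:R ^+ k / n%:R ^+ 2.
Proof.
by rewrite divr_ge0 // mulr_ge0 ?von_mangoldt_ge0 // exprn_ge0 // ln_nat_ge0.
Qed.

Lemma ln_weight_ge0 (R : realType) (k n : nat) : 0 <= ln n%:R ^+ k / n%:R ^+ 2 :> R.
Proof. by rewrite divr_ge0 // exprn_ge0 // ln_nat_ge0. Qed.

(* The factor [n^-2] is completely multiplicative, so it comes out of the
   convolution. *)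
Lemma dirichlet_conv_von_mangoldt (R : realType) (j k n : nat) : (0 < n)%N ->
  dirichlet_conv (fun n => von_mangoldt R n * ln n%:R ^+ j / n%:R ^+ 2)
                 (fun n => ln n%:R ^+ k / n%:R ^+ 2) n =
  (\sum_(1 <= d < n.+1 | (d %| n)%N)
     von_mangoldt R d * (ln d%:R ^+ j * ln (n %/ d)%:R ^+ k)) / n%:R ^+ 2.
Proof.
move=> n0; rewrite /dirichlet_conv mulr_suml; apply: eq_bigr => d dn.
have d0 : (0 < d)%N by exact: dvdn_gt0 dn.
have e0 : (0 < n %/ d)%N by rewrite divn_gt0 // dvdn_leq.
have nE : n%:R = d%:R * (n %/ d)%:R :> R by rewrite -natrM mulnC divnK.
rewrite [X in _ = _ / X ^+ 2]nE exprMn; field.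
by rewrite !pnatr_eq0 -!lt0n d0 e0.
Qed.

(** Convergence being known, Lambda * 1 = log says that the limit times zeta(2) is -zeta'(2), and
    the limit is solved for. *)
Lemma cvg_sum_von_mangoldt (R : realType) :
  (fun N => \sum_(1 <= n < N.+1)
    (von_mangoldt R n * ln n%:R ^+ 0 / n%:R ^+ 2 : R)) @ \oo
  --> zeta_deriv 1 (2 : R) / zeta_deriv 0 (2 : R).
Proof.
have cv := @is_cvg_von_mangoldt R 0; set A := limn _ in cv.
have := cvg_dirichlet_conv (@von_mangoldt_weight_ge0 R 0) (@ln_weight_ge0 R 0) cv
  (@cvg_sum_ln_pow R 0).
have -> : (fun N => \sum_(1 <= n < N.+1) dirichlet_conv
    (fun n => von_mangoldt R n * ln n%:R ^+ 0 / n%:R ^+ 2)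
    (fun n => ln n%:R ^+ 0 / n%:R ^+ 2) n) =
    fun N => \sum_(1 <= n < N.+1) (ln n%:R ^+ 1 / n%:R ^+ 2 : R).
  apply/funext => N; apply: eq_big_nat => n /andP[n0 _].
  rewrite dirichlet_conv_von_mangoldt //; congr (_ / _).
  rewrite expr1 -(@sum_von_mangoldt R n n) ?n0 ?leqnn //.
  by apply: eq_bigr => d _; rewrite !expr0 !mulr1.
move=> /(cvg_unique _ (@cvg_sum_ln_pow R 1)) -> //.
by rewrite mulfK ?gt_eqF ?zeta_deriv0_gt0.
Qed.

(* The value comes from the convolution identity
   [(Lambda log) * 1 + Lambda * log = log^2]. *)
Lemma cvg_sum_von_mangoldt_ln (R : realType) :
  (fun N => \sum_(1 <= n < N.+1)
    (von_mangoldt R n * ln n%:R ^+ 1 / n%:R ^+ 2 : R)) @ \oo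
  --> zeta_deriv 2 (2 : R) / zeta_deriv 0 (2 : R)
      - (zeta_deriv 1 (2 : R) / zeta_deriv 0 (2 : R)) ^+ 2.
Proof.
have cv := @is_cvg_von_mangoldt R 1; set B := limn _ in cv.
have c1 := cvg_dirichlet_conv (@von_mangoldt_weight_ge0 R 1) (@ln_weight_ge0 R 0) cv
  (@cvg_sum_ln_pow R 0).
have c2 := cvg_dirichlet_conv (@von_mangoldt_weight_ge0 R 0) (@ln_weight_ge0 R 1)
  (@cvg_sum_von_mangoldt R) (@cvg_sum_ln_pow R 1).
pose Z k n : R := ln n%:R ^+ k / n%:R ^+ 2.
pose W k n : R := von_mangoldt R n * ln n%:R ^+ k / n%:R ^+ 2.
have : (fun N => \sum_(1 <= n < N.+1) Z 2 n) @ \oo --> B * zeta_deriv 0 2 +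
    zeta_deriv 1 2 / zeta_deriv 0 2 * zeta_deriv 1 2.
  have -> : (fun N => \sum_(1 <= n < N.+1) Z 2 n) =
      (fun N => \sum_(1 <= n < N.+1) dirichlet_conv (W 1) (Z 0) n)
      \+ (fun N => \sum_(1 <= n < N.+1) dirichlet_conv (W 0) (Z 1) n).
    apply/funext => N /=; rewrite -big_split /=; apply: eq_big_nat => n /andP[n0 _].
    rewrite !dirichlet_conv_von_mangoldt // -mulrDl -big_split /=; congr (_ / _).
    (* One factor log n is expanded as the sum of Lambda(d) over d | n; the other splits as log d +
       log (n/d). *)
    rewrite [LHS]expr2 -{1}(@sum_von_mangoldt R n n) ?n0 ?leqnn // mulr_suml.
    apply: eq_bigr => d dn; rewrite !expr0 !expr1 mulr1 mul1r -mulrDr; congr (_ * _).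
    have d0 : (0 < d)%N by exact: dvdn_gt0 dn.
    have e0 : (0 < n %/ d)%N by rewrite divn_gt0 // dvdn_leq.
    by rewrite -lnM ?posrE ?ltr0n // -natrM mulnC divnK.
  exact: cvgD c1 c2.
move=> /(cvg_unique _ (@cvg_sum_ln_pow R 2)) -> //.
suff -> : (B * zeta_deriv 0 2 + zeta_deriv 1 2 / zeta_deriv 0 2 * zeta_deriv 1 2) /
    zeta_deriv 0 2 - (zeta_deriv 1 2 / zeta_deriv 0 2) ^+ 2 = B by [].
by field; rewrite gt_eqF ?zeta_deriv0_gt0.
Qed.

(** * The sum over common divisors *)

Lemma sum_von_mangoldt_div_le (R : realType) (N : nat) : (0 < N)%N ->
  \sum_(1 <= d < N.+1) von_mangoldt R d / d%:R <= 2 * ln N%:R.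
Proof.
move=> N0; have N0R : 0 < N%:R :> R by rewrite ltr0n.
(* Summing Lambda * 1 = log up to [N]: both sides are log N!. *)
have H : \sum_(1 <= d < N.+1) von_mangoldt R d * (N %/ d)%:R =
    \sum_(1 <= n < N.+1) ln n%:R.
  have := sum_dirichlet_conv (von_mangoldt R) (fun=> 1) N.
  under [RHS]eq_bigr do rewrite sum_ones_divn.
  move=> <-; apply: eq_big_nat => n /andP[n0 _].
  rewrite -(@sum_von_mangoldt R n n) ?n0 ?leqnn //.
  by apply: eq_bigr => *; rewrite mulr1.
have H2 : \sum_(1 <= n < N.+1) ln n%:R <= N%:R * ln N%:R :> R.
  apply: (@le_trans _ _ (\sum_(1 <= n < N.+1) ln N%:R)).
    apply: ler_sum_nat => n /andP[n0 nN].
    by rewrite ler_ln ?posrE ?ltr0n // ler_nat.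
  by rewrite big_const_nat subn1 iter_addr_0 /= mulr_natl.
(* [N / d <= 2 * (N %/ d)] *)
rewrite -(ler_pM2l N0R) mulrCA; apply: le_trans (ler_wpM2l _ H2) => //.
rewrite -H !mulr_sumr; apply: ler_sum_nat => d /andP[d0 dN].
rewrite mulrCA [leRHS]mulrCA ler_wpM2l ?von_mangoldt_ge0 //.
have d0R : 0 < d%:R :> R by rewrite ltr0n.
rewrite ler_pdivrMr // -!natrM ler_nat.
have := ltn_ceil N d0; have : (0 < N %/ d)%N by rewrite divn_gt0.
by set q := (N %/ d)%N; nia.
Qed.

(** With p = t^(1/4), 1 + 2 log t = 1 + 8 log p <= 8 p - 7; squaring 8 p gives the constant 64. *)
Lemma sqr_ln_le_sqrt (R : realType) (t : R) : 1 <= t ->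
  (1 + 2 * ln t) ^+ 2 <= 64 * Num.sqrt t.
Proof.
move=> t1; have st1 : 1 <= Num.sqrt t by rewrite -[leLHS]sqrtr1 ler_wsqrtr.
set p := Num.sqrt (Num.sqrt t).
have p1 : 1 <= p by rewrite -[leLHS]sqrtr1 ler_wsqrtr.
have l0 := ln_ge0 t1.
have lE : ln t = 4 * ln p.
  by rewrite /p !ln_sqrt ?sqrtr_gt0 //; lra.
have lp : ln p <= p - 1 by have := @ln_sub_le R 1 p ltr01; rewrite ln1 divr1; lra.
have -> : Num.sqrt t = p ^+ 2 by rewrite sqr_sqrtr // sqrtr_ge0.
have -> : 64 * p ^+ 2 = (8 * p) ^+ 2 by rewrite exprMn; congr (_ * _); ring.
by rewrite ler_pXn2r ?nnegrE //; lra.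
Qed.

(* The terms with [d > sqrt K]: there [s = sqrt K], [D = d] and [K / d^2 < 1], and
   the bound is summable with the weight [d^(-3/2)]. *)
Lemma main_term_tail_le (R : realType) (s D c lam : R) :
  1 <= s -> s <= D -> 1 <= 2 * ln s -> `|c| <= 1 -> 0 <= lam <= ln D ->
  `|lam * (s * s / (D * D) * ln (s * s / (D * D)) + c * (s * s / (D * D)))| <=
  64 * ln s * (s * Num.sqrt s) * (D * Num.sqrt D)^-1.
Proof.
move=> s1 sD ls c1 /andP[lam0 lamD].
have s0 : 0 < s by lra.
have D0 : 0 < D by lra.
have t1 : 1 <= D / s by rewrite ler_pdivlMr // mul1r.
have := sqr_ln_le_sqrt t1; have lt0 := ln_ge0 t1.
have lD : ln D = ln s + ln (D / s) by rewrite ln_div ?posrE //; lra.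
have ly : ln (s * s / (D * D)) = - (2 * ln (D / s)).
  by rewrite !ln_div ?posrE ?mulr_gt0 // !lnM ?posrE //; lra.
have a0 : 0 < Num.sqrt s by rewrite sqrtr_gt0.
have b0 : 0 < Num.sqrt D by rewrite sqrtr_gt0.
have -> : Num.sqrt (D / s) = Num.sqrt D / Num.sqrt s.
  by rewrite sqrtrM ?sqrtrV //; lra.
rewrite ly; move: lD lt0; set l := ln (D / s) => lD lt0 Hl.
set y := s * s / (D * D); have y0 : 0 < y by rewrite divr_gt0 // mulr_gt0.
have -> : lam * (y * - (2 * l) + c * y) = lam * y * (c - 2 * l) by ring.
have -> : 64 * ln s * (s * Num.sqrt s) * (D * Num.sqrt D)^-1 =
    y * (ln s * (64 * (Num.sqrt D / Num.sqrt s))).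
  have sE : s = Num.sqrt s * Num.sqrt s by rewrite -expr2 sqr_sqrtr // ltW.
  have DE : D = Num.sqrt D * Num.sqrt D by rewrite -expr2 sqr_sqrtr // ltW.
  rewrite /y; move: (Num.sqrt s) (Num.sqrt D) a0 b0 sE DE (ln s) => a b a0 b0 sE DE L.
  by rewrite sE DE; field; rewrite !gt_eqF.
clearbody y.
have cl : `|c - 2 * l| <= 1 + 2 * l.
  by move: c1; rewrite !ler_norml => /andP[? ?]; apply/andP; split; lra.
rewrite !normrM (ger0_norm lam0) (gtr0_norm y0) -mulrA mulrCA ler_wpM2l ?(ltW y0) //.
apply: (@le_trans _ _ (ln D * (1 + 2 * l))); first exact: ler_pM.
(* From 1 <= 2 log s follows log D = log s + l <= log s (1 + 2 l), the source of the second
   factor. *)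
apply: (@le_trans _ _ (ln s * (1 + 2 * l) ^+ 2)); last by rewrite ler_wpM2l //; lra.
by rewrite lD expr2 mulrA ler_wpM2r; nra.
Qed.

(** The sums are cut at [r], the integer part of sqrt K: the head costs 13 and the tail 128. The
    bound does not depend on [M], which is sent to infinity afterwards. *)
Lemma common_divisor_part_partial (R : realType) (K M : nat) :
  (0 < K)%N -> 1 <= ln K%:R :> R -> (K <= M)%N ->
  `|\sum_(1 <= d < K.+1) von_mangoldt R d * (divisor_sum (K %/ (d * d)))%:R
   - \sum_(1 <= d < M.+1) von_mangoldt R d *
      (K%:R / (d * d)%:R * ln (K%:R / (d * d)%:R)
       + (2 * euler_gamma R - 1) * (K%:R / (d * d)%:R))|
  <= 141 * (Num.sqrt K%:R * ln K%:R).
Proof.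
move=> K0 lK1 KM; set s : R := Num.sqrt K%:R; pose r := Num.truncn s.
have [s1 ss r0 rK] := isqrt_itv R K0; rewrite -/s -/r in s1 ss r0 rK.
have [r1 rs sr] := truncn_ge1_itv s1; rewrite -/r in r1 rs sr.
have lnK : ln K%:R = 2 * ln s by rewrite ln_sqrt ?ltr0n //; lra.
have rK' : (r <= K)%N by nia.
set c := 2 * euler_gamma R - 1.
have c1 : `|c| <= 1.
  have /andP[? ?] := euler_gamma_itv R.
  by rewrite ler_norml; apply/andP; split; rewrite /c; lra.
pose G d := von_mangoldt R d * (K%:R / (d * d)%:R * ln (K%:R / (d * d)%:R)
  + c * (K%:R / (d * d)%:R)).
rewrite -[\sum_(1 <= d < M.+1) _]/(\sum_(1 <= d < M.+1) G d).
(* For [d > r] the integer quotient [K %/ (d * d)] is 0. *)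
have -> : \sum_(1 <= d < K.+1) von_mangoldt R d * (divisor_sum (K %/ (d * d)))%:R =
    \sum_(1 <= d < r.+1) von_mangoldt R d * (divisor_sum (K %/ (d * d)))%:R.
  rewrite (big_cat_nat (n := r.+1)) //= [X in _ + X = _]big_nat.
  rewrite [X in _ + X = _]big1 ?addr0 // => d /andP[rd dK].
  rewrite divn_small; last by nia.
  by rewrite /divisor_sum big_geq // mulr0.
rewrite (big_cat_nat (n := r.+1) (p := M.+1)) //=; last by rewrite ltnS (leq_trans rK').
have head : `|\sum_(1 <= d < r.+1) von_mangoldt R d * (divisor_sum (K %/ (d * d)))%:R -
    \sum_(1 <= d < r.+1) G d| <= 13 * (s * ln K%:R).
  apply: le_trans (ler_norm_sum_nat (e := fun d => 13 * s * (von_mangoldt R d / d%:R)) _) _.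
    move=> d /andP[d0 dr]; rewrite /G -mulrBr normrM ger0_norm ?von_mangoldt_ge0 //.
    rewrite [leRHS]mulrCA ler_wpM2l ?von_mangoldt_ge0 //.
    have dd0 : (0 < d * d)%N by rewrite muln_gt0 d0.
    have y1 : 1 <= K%:R / (d * d)%:R :> R.
      by rewrite ler_pdivlMr ?ltr0n // mul1r ler_nat; nia.
    have := divisor_sum_real_approx y1; rewrite truncn_div_nat // => /le_trans; apply.
    rewrite sqrtrM // sqrtrV // natrM -expr2 sqrtr_sqr ger0_norm // -/s.
    by rewrite mulrA.
  rewrite -mulr_sumr -!mulrA ler_wpM2l // ler_wpM2l //; first lra.
  apply: (le_trans (sum_von_mangoldt_div_le R r0)).
  by rewrite lnK ler_pM2l // ler_ln // posrE; lra.
have tail : `|\sum_(r.+1 <= d < M.+1) G d| <= 128 * (s * ln K%:R).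
  apply: le_trans (ler_norm_sum _ _ _) _.
  have s0 : 0 < s by lra.
  have ls0 : 0 <= ln s by exact: ln_ge0.
  have e0 : 0 <= 64 * ln s * (s * Num.sqrt s).
    by rewrite !mulr_ge0 // ?sqrtr_ge0 // ltW.
  apply: (@le_trans _ _ (\sum_(r.+1 <= d < M.+1)
     64 * ln s * (s * Num.sqrt s) * (d%:R * Num.sqrt d%:R)^-1)).
    apply: ler_sum_nat => d /andP[rd _].
    have sd : s <= d%:R.
      by apply: (le_trans (ltW sr)); rewrite natr1 ler_nat.
    rewrite /G natrM -ss; apply: main_term_tail_le => //; first by rewrite -lnK.
    by rewrite von_mangoldt_ge0 von_mangoldt_le_ln.
  rewrite -mulr_sumr.
  apply: le_trans (ler_wpM2l e0 (@sum_inv_mul_sqrt_tail R r M r0)) _.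
  have rr0 : 0 < Num.sqrt r%:R :> R by rewrite sqrtr_gt0 ltr0n.
  (* This gives 64 * 2 * 2 = 256 times s log s, which is 128 s log K. *)
  have srr : Num.sqrt s <= 2 * Num.sqrt r%:R.
    rewrite -[2 * _]ger0_norm; last by rewrite mulr_ge0 // ltW.
    rewrite -sqrtr_sqr exprMn sqr_sqrtr // ler_wsqrtr //; lra.
  rewrite lnK [leLHS]mulrA ler_pdivrMr //.
  have := ler_wpM2l (mulr_ge0 (ltW s0) ls0) srr; lra.
rewrite opprD addrA; apply: le_trans (ler_normB _ _) _.
by move: head tail; lra.
Qed.

(** Splitting log (K / d^2) as log K - 2 log d writes the truncated main term through the partial
    sums of the two Lambda series, and [M] tends to infinity. *)
Lemma common_divisor_part_approx (R : realType) (K : nat) :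
  let A := zeta_deriv 1 (2 : R) / zeta_deriv 0 (2 : R) in
  let B := zeta_deriv 2 (2 : R) / zeta_deriv 0 (2 : R) - A ^+ 2 in
  (0 < K)%N -> 1 <= ln K%:R :> R ->
  `|\sum_(1 <= d < K.+1) von_mangoldt R d * (divisor_sum (K %/ (d * d)))%:R
   - (A * (K%:R * ln K%:R) + ((2 * euler_gamma R - 1) * A - 2 * B) * K%:R)|
  <= 141 * (Num.sqrt K%:R * ln K%:R).
Proof.
move=> A B K0 lK1; set S := \sum_(_ <= _ < _) _; set c := 2 * euler_gamma R - 1.
pose W k N : R := \sum_(1 <= n < N.+1) (von_mangoldt R n * ln n%:R ^+ k / n%:R ^+ 2).
have cA : W 0%N @ \oo --> A by exact: cvg_sum_von_mangoldt.
have cB : W 1%N @ \oo --> B by exact: cvg_sum_von_mangoldt_ln.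
have cS : (fun N => `|S - ((K%:R * ln K%:R + c * K%:R) * W 0%N N - 2 * K%:R * W 1%N N)|)
    @ \oo --> `|S - ((K%:R * ln K%:R + c * K%:R) * A - 2 * K%:R * B)|.
  apply: cvg_norm.
  exact: cvgB (cvg_cst _) (cvgB (cvgM (cvg_cst _) cA) (cvgM (cvg_cst _) cB)).
have -> : A * (K%:R * ln K%:R) + (c * A - 2 * B) * K%:R =
  (K%:R * ln K%:R + c * K%:R) * A - 2 * K%:R * B by ring.
rewrite -(cvg_lim _ cS) //; apply: limr_le; first exact: cvgP cS.
exists K => // M /= KM.
have := common_divisor_part_partial K0 lK1 KM; rewrite -/S -/c.
set F := \sum_(_ <= _ < _) _.
suff -> : F = (K%:R * ln K%:R + c * K%:R) * W 0%N M - 2 * K%:R * W 1%N M by [].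
rewrite /F /W !mulr_sumr -sumrB; apply: eq_big_nat => d /andP[d0 _].
have d0R : 0 < d%:R :> R by rewrite ltr0n.
rewrite natrM ln_div ?posrE ?mulr_gt0 ?ltr0n // lnM ?posrE //.
by field; rewrite gt_eqF.
Qed.

(** * The constants and the final estimate *)

Lemma C_logE (R : realType) : C_log R = zeta_deriv 1 2 / zeta_deriv 0 2.
Proof. by rewrite /C_log derive1_zeta ?zeta_deriv0; [rewrite mulNr opprK | lra]. Qed.

(** This is the coefficient of [K] in [common_divisor_part_approx]; the quotient z''/z' is cleared
    because zeta'(2) is nonzero. *)
Lemma D_logE (R : realType) :
  D_log R = (2 * euler_gamma R - 1) * C_log R
   - 2 * (zeta_deriv 2 2 / zeta_deriv 0 2 - C_log R ^+ 2).
Proof.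
rewrite C_logE /D_log derive1n2_zeta derive1_zeta ?zeta_deriv0; last by lra.
by field; rewrite !gt_eqF ?zeta_deriv0_gt0 ?zeta_deriv1_gt0.
Qed.

(** Needed because the sum depends only on the integer part of [x]. The largest change, that of x
    log^2 x, is at most log^2 x + 2 log x, and log x <= 2 sqrt x. *)
Lemma main_term_truncn (R : realType) (a b x : R) : 1 <= ln x -> 1 <= x ->
  `|x * ln x ^+ 2 + a * (x * ln x) - b * x
    - ((Num.truncn x)%:R * ln (Num.truncn x)%:R ^+ 2
       + a * ((Num.truncn x)%:R * ln (Num.truncn x)%:R) - b * (Num.truncn x)%:R)| <=
  (4 + 2 * `|a| + `|b|) * (Num.sqrt x * ln x).
Proof.
move=> l1 x1; have [q1 qx xq] := truncn_ge1_itv x1.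
set q : R := (Num.truncn x)%:R in q1 qx xq *.
have q0 : 0 < q by lra.
have x0 : 0 < x by lra.
have s1 : 1 <= Num.sqrt x by rewrite -[leLHS]sqrtr1 ler_wsqrtr.
have ls := ln_le_sqrt x0.
have lq0 := ln_ge0 q1.
have lqx : ln q <= ln x by rewrite ler_ln.
have := ln_sub_le q0 x0; rewrite ler_pdivlMr // => hq.
move: (Num.sqrt x) (ln x) (ln q) s1 ls l1 lq0 lqx hq => s l m s1 ls l1 m0 ml hq.
have h1 : `|x * l ^+ 2 - q * m ^+ 2| <= 4 * (s * l).
  have -> : x * l ^+ 2 - q * m ^+ 2 = (x - q) * l ^+ 2 + (l - m) * q * (l + m) by ring.
  have a1 : 0 <= (x - q) * l ^+ 2 <= l ^+ 2.
    by rewrite mulr_ge0 ?sqr_ge0 //=; [rewrite ler_piMl ?sqr_ge0 //; lra | lra].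
  have a2 : 0 <= (l - m) * q * (l + m) <= 2 * l.
    have lm0 : 0 <= (l - m) * q by apply: mulr_ge0; lra.
    have lm1 : (l - m) * q <= 1 by lra.
    rewrite mulr_ge0 //=; last by lra.
    by rewrite -[leRHS]mul1r ler_pM //; lra.
  have a3 : l ^+ 2 <= 2 * s * l by rewrite expr2 ler_wpM2r //; lra.
  have a4 : l <= s * l by rewrite ler_peMl //; lra.
  by rewrite ger0_norm; lra.
have h2 : `|x * l - q * m| <= 2 * (s * l).
  have -> : x * l - q * m = (x - q) * l + (l - m) * q by ring.
  rewrite ger0_norm; nra.
have h3 : `|x - q| <= s * l by rewrite ger0_norm; nra.
have -> : x * l ^+ 2 + a * (x * l) - b * x - (q * m ^+ 2 + a * (q * m) - b * q) =
  (x * l ^+ 2 - q * m ^+ 2) + a * (x * l - q * m) - b * (x - q) by ring.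
apply: le_trans (ler_normB _ _) _; rewrite [leRHS]mulrDl lerD //; last first.
  by rewrite normrM ler_wpM2l.
apply: le_trans (ler_normD _ _) _; rewrite [leRHS]mulrDl lerD //.
by rewrite normrM -mulrA [leRHS]mulrCA ler_wpM2l.
Qed.

Theorem theorem5 (R : realType) :
  (fun x : R => sum_log_lcm x) =
  (fun x : R => x * ln x ^+ 2
     + (2 * euler_gamma R - 2 - C_log R) * (x * ln x)
     - (2 * euler_gamma R - 2 + D_log R) * x)
  +O_ (+oo_R) (fun x : R => x `^ (1 / 2) * ln x).
Proof.
apply/eqaddOP.
set a := 2 * euler_gamma R - 2 - C_log R; set b := 2 * euler_gamma R - 2 + D_log R.
near=> k; near=> x.
(* This makes the integer part of [x] at least e, hence its logarithm at least 1. *)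
have xe : expR 1 + 1 <= x by near: x; apply: nbhs_pinfty_ge; exact: num_real.
(* Here 173 = 32 + 141: twice the bound 8 sqrt K (1 + log K) is at most 32 sqrt K log K, and 141
   comes from the common divisors. *)
have kC : 173 + (4 + 2 * `|a| + `|b|) <= k.
  by near: k; apply: nbhs_pinfty_ge; exact: num_real.
have e1 : 1 < expR 1 :> R by rewrite expR_gt1.
have x1 : 1 <= x by lra.
have [q1 qx xq] := truncn_ge1_itv x1.
set K := Num.truncn x in q1 qx xq *.
have K0 : (0 < K)%N by rewrite -(ltr0n R); lra.
have K0R : 0 < K%:R :> R by lra.
have lK1 : 1 <= ln K%:R :> R.
  by rewrite -[leLHS](expRK (1 : R)) ler_ln ?posrE ?expR_gt0 //; lra.
have lKx : ln K%:R <= ln x by rewrite ler_ln // posrE; lra.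
have lx1 : 1 <= ln x by lra.
have sKx : Num.sqrt K%:R <= Num.sqrt x by rewrite ler_wsqrtr.
have s0 : 0 <= Num.sqrt x by exact: sqrtr_ge0.
have -> : x `^ (1 / 2) = Num.sqrt x by rewrite mul1r powR12_sqrt //; lra.
have E1 := main_term_truncn a b lx1 x1; rewrite /= -/K in E1.
have E2 := sum_ln_hyperbola_approx R K0.
have E3 := common_divisor_part_approx K0 lK1; rewrite /= -!C_logE -D_logE in E3.
have E4 : Num.sqrt K%:R * ln K%:R <= Num.sqrt x * ln x.
  by apply: ler_pM => //; lra.
have E5 : Num.sqrt K%:R * 1 <= Num.sqrt K%:R * ln K%:R :> R.
  by rewrite ler_wpM2l // sqrtr_ge0.
rewrite -[(_ - _) x]/(sum_log_lcm x - (x * ln x ^+ 2 + a * (x * ln x) - b * x)).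
rewrite sum_log_lcm_decomposition -/K; last by lra.
rewrite [`|Num.sqrt x * ln x|]ger0_norm; last by apply: mulr_ge0 => //; lra.
have P0 : 0 <= Num.sqrt x * ln x by apply: mulr_ge0 => //; lra.
have := ler_wpM2r P0 kC => /(le_trans _); apply.
move: E1 E2 E3 E4 E5; set L := \sum_(_ <= _ < _) ln _ * _.
set G := \sum_(_ <= _ < _) _ * _.
rewrite !ler_norml => /andP[u1 u2] /andP[v1 v2] /andP[w1 w2] E4 E5.
by rewrite /a /b in u1 u2 *; apply/andP; split; lra.
Unshelve. all: by end_near. Qed.
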